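(* Let $G$ be a monoid and $\hat G$ a category with $G\subset\hat G$ (as a sub-category), and let $\hat G$ act on the left by isometries on a $\delta$-hyperbolic complex $X$ with base point $P$. Suppose that the automatic normal form hypothesis (with finite alphabet $\mathcal S$ of arrows of $\hat G$) and the geodesic words hypothesis are satisfied, and that there are interesting loxodromic actions. Then $$\liminf_{l\to\infty}\frac{\#\{g\in B(l) : g \text{ is rigid and acts loxodromically on } X\}}{\#B(l)}>0 .$$
   Context: Setting. A monoid is a category with one object. $\mathcal S$ is a finite set of arrows of $\hat G$; a product $g_1g_2$ of arrows is defined if the target object of $g_1$ is the source object of $g_2$. An action of $\hat G$ on $X$ by isometries assigns to each arrow $g$ an isometry $x\mapsto g.x$ of $X$, with $(gh).x=g.(h.x)$ whenever $gh$ is defined. $X$ is a geodesic $\delta$-hyperbolic space (not necessarily proper), and $P\in X$ is a fixed base point. Automata. A deterministic finite state automaton (FSA) over $\mathcal S$ is a finite directed graph whose vertices are called states and whose edges are labelled by $\mathcal S$, with exactly one outgoing edge for each letter at each state; there is a unique start state (not the target of any arrow), a unique fail state (all edges leaving it loop back to it), and a set of accept states. A word is accepted (recognized) if the path starting at the start state and following the letters of the word ends in an accept state. An automaton (or sub-automaton) is recurrent if there is an integer $l$ such that for any two (possibly equal) states other than the start and fail states there is a path of length exactly $l$ from the first to the second. The accessible states are the (non-fail) states that can be reached from every non-fail state; together with the edges connecting them they form the accessible sub-automaton. The FSA is dominated by its accessible sub-automaton if the latter is non-empty, recurrent, and the exponential growth rate of the number of words readable in the accessible sub-automaton is strictly larger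 than that of the original automaton with the accessible sub-automaton removed. Automatic normal form hypothesis. Every element of $G$ has a unique preferred word over $\mathcal S$ representing it (its normal form), and the language of normal forms is recognized by a deterministic FSA such that (i) the automaton is dominated by its accessible sub-automaton, and (ii) there is at least one word $w_{\rm rigid}$ such that $w_{\rm rigid}$ and $w_{\rm rigid}^2$ are both accepted, the paths traced out by these two words end in the same accept state $E$, and $E$ lies in the accessible sub-automaton. $B(l)$ denotes the set of elements of $G$ whose normal form has length at most $l$. A word $w$ is rigid if $w^n$ ($w$ repeated $n$ times) is accepted by the automaton for all positive integers $n$; an element of $G$ is rigid if its normal form word is rigid. Geodesic words hypothesis. There is a constant $R\ge 0$ such that for every normal form word $x_1x_2x_3\ldots$ and all integers $0\le i<j$ (with $j$ at most the length of the word), the points $x_1\cdots x_i.P,\ x_1\cdots x_{i+1}.P,\ \ldots,\ x_1\cdots x_j.P$ all lie in the $R$-neighbourhood of every geodesic connecting the two end-points $x_1\cdots x_i.P$ and $x_1\cdots x_j.P$. An isometry $\varphi$ of $X$ acts loxodromically if $\lim_{n\to\infty}\frac1n d_X(P,\varphi^n(P))$ exists and is positive. There are interesting loxodromic actions if there is a loop in the accessible sub-automaton such that the product of the elements of $\mathcal S$ read along this loop acts loxodromically on $X$. *)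

(* Defs.v *)
From HB Require Import structures.
From mathcomp Require Import all_boot all_order all_algebra.
From mathcomp Require Import finmap.
From mathcomp Require Import all_classical all_reals all_analysis.

Set Implicit Arguments.
Unset Strict Implicit.
Unset Printing Implicit Defensive.

Import Order.TTheory GRing.Theory Num.Theory numFieldNormedType.Exports.

Local Open Scope classical_set_scope.
Local Open Scope ring_scope.

(* One-sorted presentation of a category. The product [comp g h] is only
   meaningful when [tgt g = src h]; its value is unspecified otherwise, and
   every axiom carries that guard. *)
Record category := Category {
  ob : Type;
  arr : Type;
  src : arr -> ob;
  tgt : arr -> ob;
  idc : ob -> arr;
  comp : arr -> arr -> arr;
  src_idc : forall x, src (idc x) = x;
  tgt_idc : forall x, tgt (idc x) = x;
  src_comp : forall g h, tgt g = src h -> src (comp g h) = src g;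
  tgt_comp : forall g h, tgt g = src h -> tgt (comp g h) = tgt h;
  comp_idl : forall g, comp (idc (src g)) g = g;
  comp_idr : forall g, comp g (idc (tgt g)) = g;
  comp_assoc : forall f g h, tgt f = src g -> tgt g = src h ->
    comp f (comp g h) = comp (comp f g) h
}.

(* G is (the set of arrows of) a sub-category whose only object is o,
   that is, a monoid. *)
Record submonoid_at (C : category) (o : ob C) (G : set (arr C)) : Prop := {
  submonoid_src : forall g, G g -> src g = o;
  submonoid_tgt : forall g, G g -> tgt g = o;
  submonoid_id : G (idc o);
  submonoid_comp : forall g h, G g -> G h -> G (comp g h)
}.

Section Words.
Variables (C : category) (S : finType) (letter : S -> arr C).

Fixpoint word_defined (x : ob C) (w : seq S) : Prop :=
  if w is s :: w' then src (letter s) = x /\ word_defined (tgt (letter s)) w'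
  else True.

(* The product of the letters of w, meaningful if [word_defined x w]; the base
   object x only serves to make the product of the empty word [idc x]. *)
Fixpoint word_arrow (x : ob C) (w : seq S) : arr C :=
  if w is s :: w' then comp (letter s) (word_arrow (tgt (letter s)) w')
  else idc x.

Definition represents (x : ob C) (w : seq S) (g : arr C) : Prop :=
  word_defined x w /\ word_arrow x w = g.

End Words.

Section Geometry.
Variables (R : realType) (X : metricType R).

Definition is_geodesic (x y : X) (c : R -> X) : Prop :=
  [/\ c 0 = x, c (mdist x y) = y &
      forall s t, 0 <= s <= mdist x y -> 0 <= t <= mdist x y ->
        mdist (c s) (c t) = `|s - t|].

Definition geodesic_image (x y : X) (c : R -> X) : set X :=
  c @` `[0, mdist x y].

Definition geodesic_space : Prop :=
  forall x y : X, exists c, is_geodesic x y c.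

Definition in_nbhd (r : R) (A : set X) (x : X) : Prop :=
  exists2 a, A a & mdist x a <= r.

(* All geodesic triangles are delta-thin. *)
Definition hyperbolic (delta : R) : Prop :=
  forall (x y z : X) (cxy cyz cxz : R -> X),
    is_geodesic x y cxy -> is_geodesic y z cyz -> is_geodesic x z cxz ->
    forall p, geodesic_image x z cxz p ->
      in_nbhd delta (geodesic_image x y cxy `|` geodesic_image y z cyz) p.

Definition isometry_of (f : X -> X) : Prop :=
  bijective f /\ forall x y, mdist (f x) (f y) = mdist x y.

Definition loxodromic (P : X) (f : X -> X) : Prop :=
  exists2 c : R, 0 < c &
    mdist P (iter n f P) / n%:R @[n --> \oo] --> c.

(* Identities automatically act trivially: an idempotent isometry is the
   identity map. *)
Record isometric_action (C : category) (act : arr C -> X -> X) : Prop := {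
  act_isometry : forall g, isometry_of (act g);
  act_comp : forall g h, tgt g = src h ->
    forall x, act (comp g h) x = act g (act h x)
}.

End Geometry.

Record fsa (S : finType) := FSA {
  state : finType;
  start : state;
  fail : state;
  accept : {set state};
  step : state -> S -> state;
  start_not_target : forall q s, step q s != start;
  fail_loops : forall s, step fail s = fail;
  fail_not_accept : fail \notin accept
}.

Section Automata.
Variables (S : finType) (A : fsa S).

Definition run (q : state A) (w : seq S) : state A := foldl (@step S A) q w.

Definition accepts (w : seq S) : bool := run (start A) w \in accept A.

(* Sub-automata are given by their sets of states, with all the edges of A
   that connect these states. [run_within B q w]: the path that starts at q and
   reads w has all its states, including q, in B. *)
Definition run_within (B : {set state A}) (q : state A) (w : seq S) : bool :=
  (q \in B) && all (mem B) (scanl (@step S A) q w).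

Definition recurrent (B : {set state A}) : Prop :=
  exists l : nat, forall p q,
    p \in B :\: [set start A; fail A] -> q \in B :\: [set start A; fail A] ->
    exists w : seq S, [/\ size w = l, run_within B p w & run p w = q].

Definition edge : rel (state A) := [rel p q | [exists s, step p s == q]].

Definition accessible : {set state A} :=
  [set q | (q != fail A) && [forall p, (p != fail A) ==> connect edge p q]]%SET.

(* The automaton with the accessible part removed. The fail state is removed
   too: it carries all words, so its growth rate would always be maximal. *)
Definition remainder : {set state A} := ~: (fail A |: accessible)%SET.

Definition num_readable (B : {set state A}) (n : nat) : nat :=
  #|[set w : n.-tuple S | [exists q, run_within B q w]]%SET|.

Definition growth_rate (R : realType) (a : nat -> nat) : \bar R :=
  limn_esup (fun n => (((a n)%:R : R) `^ (n%:R^-1))%:E).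

Definition dominated_by_accessible (R : realType) : Prop :=
  [/\ accessible != finset.set0,
      recurrent accessible &
      (growth_rate R (num_readable remainder) <
       growth_rate R (num_readable accessible))%E].

Definition word_pow (w : seq S) (n : nat) : seq S := flatten (nseq n w).

Definition rigid (w : seq S) : Prop :=
  forall n, (0 < n)%N -> accepts (word_pow w n).

End Automata.

Section Hypotheses.
Variables (R : realType) (C : category) (o : ob C) (G : set (arr C)).
Variables (X : metricType R) (act : arr C -> X -> X) (P : X).
Variables (S : finType) (letter : S -> arr C) (A : fsa S).
(* [nf g] is the normal form of g for g in G, and irrelevant otherwise. *)
Variable nf : arr C -> seq S.

Record automatic_normal_form : Prop := {
  nf_represents : forall g, G g -> represents letter o (nf g) g;
  nf_recognized : forall w, accepts A w <-> exists2 g, G g & nf g = w;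
  nf_dominated : dominated_by_accessible A R;
  nf_rigid : exists w : seq S,
    [/\ accepts A w, accepts A (word_pow w 2),
        run (start A) w = run (start A) (word_pow w 2) &
        run (start A) w \in accessible A]
}.

Definition orbit_point (w : seq S) (k : nat) : X :=
  act (word_arrow letter o (take k w)) P.

Definition geodesic_words : Prop :=
  exists2 r : R, 0 <= r &
    forall g, G g -> forall i j k : nat,
      (i < j <= size (nf g))%N -> (i <= k <= j)%N ->
      forall c, let x := orbit_point (nf g) i in let y := orbit_point (nf g) j in
        is_geodesic x y c ->
        in_nbhd r (geodesic_image x y c) (orbit_point (nf g) k).

Definition interesting_loxodromic : Prop :=
  exists (q : state A) (u : seq S) (x : ob C),
    [/\ run_within (accessible A) q u, run q u = q,
        word_defined letter x u & loxodromic P (act (word_arrow letter x u))].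

Definition nf_ball (l : nat) : set (arr C) :=
  [set g | G g /\ (size (nf g) <= l)%N].

Definition rigid_loxodromic (g : arr C) : Prop :=
  rigid A (nf g) /\ loxodromic P (act g).

End Hypotheses.

(* Cardinal of a finite set of elements of an arbitrary type. *)
Definition finite_card (T : Type) (B : set T) : nat := #|` fset_set (B : set {classic T})|.

(* Main.v *)
(* By the geodesic words hypothesis, the displacements d(P, g^n.P) of a rigid
   element g are additive up to a constant 2r, so that d(P, g.P) > 2r already
   forces g to be loxodromic; this happens as soon as the normal form of g contains
   a subword U with d(P, U.P) > 6r, and a high power of the loxodromic loop is such
   a U. Let a(n) be the number of words of length n readable in the accessible
   part. Recurrence yields a(m) a(n) <= K a(m + n), so that domination bounds the
   number of normal forms of length n by K' a(n): a path runs first in the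
   remainder, then in the accessible part. Conversely, every readable word u of
   length m extends to a word w_rigid z U x u y with z, x, y of fixed length, where
   z U x u y is a loop at the state E reached by w_rigid; this produces at least
   a(m) rigid words of length m + D through U, which are loxodromic. *)

Require Import Defs.
From mathcomp Require Import all_boot all_order all_algebra.
From mathcomp Require Import finmap.
From mathcomp Require Import all_classical all_reals all_analysis.
From mathcomp Require Import zify ring lra.

Set Implicit Arguments.
Unset Strict Implicit.
Unset Printing Implicit Defensive.

Import Order.TTheory GRing.Theory Num.Theory numFieldNormedType.Exports.

Local Open Scope classical_set_scope.
Local Open Scope ring_scope.

(** * Counting words of a fixed length *)

Section CountWords.
Variable S : finType.
Implicit Types (p q r : pred (seq S)) (m n k : nat).
Local Open Scope nat_scope.

Definition count_words (n : nat) (p : pred (seq S)) : nat :=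
  #|[set w : n.-tuple S | p w]%SET|.

Lemma count_wordsE n p : count_words n p = \sum_(w : n.-tuple S) p w.
Proof.
rewrite /count_words -sum1_card big_mkcond /=.
by apply: eq_bigr => w _; rewrite finset.inE; case: (p w).
Qed.

Lemma count_words_cat m n p :
  count_words (m + n) p = \sum_(u : m.-tuple S) count_words n (fun v => p (u ++ v)).
Proof.
pose h (x : m.-tuple S * n.-tuple S) := cat_tuple x.1 x.2.
have h_inj : injective h.
  move=> [u v] [u' v'] /(congr1 val) /= /eqP.
  rewrite eqseq_cat ?size_tuple// => /andP[/eqP uu' /eqP vv'].
  by congr pair; apply: val_inj.
have h_bij : bijective h.
  by apply: inj_card_bij h_inj _; rewrite card_prod !card_tuple expnD.
rewrite count_wordsE (reindex h) /=; last exact: onW_bij.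
rewrite -(pair_bigA _ (fun (u : m.-tuple S) (v : n.-tuple S) => nat_of_bool (p (u ++ v)))) /=.
by apply: eq_bigr => u _; rewrite count_wordsE.
Qed.

Lemma leq_count_words n p q : (forall w, size w = n -> p w -> q w) ->
  count_words n p <= count_words n q.
Proof.
move=> pq; apply: subset_leq_card; apply/fintype.subsetP => w.
by rewrite !finset.inE; apply: pq; rewrite size_tuple.
Qed.

Lemma leq_count_words_or n p q :
  count_words n (fun w => p w || q w) <= count_words n p + count_words n q.
Proof.
rewrite !count_wordsE -big_split /=; apply: leq_sum => w _.
by case: (p w); case: (q w).
Qed.

Lemma leq_count_words_ex n k (p : nat -> pred (seq S)) :
  count_words n (fun w => [exists i : 'I_k, p i w]) <=
    \sum_(i < k) count_words n (p i).
Proof.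
under [X in _ <= X]eq_bigr do rewrite count_wordsE.
rewrite exchange_big /= count_wordsE; apply: leq_sum => w _.
case: existsP => // -[i piw].
by rewrite (bigD1 i) //= piw.
Qed.

Lemma count_wordsT n : count_words n xpredT = #|S| ^ n.
Proof. by rewrite -card_tuple -cardsT; apply: eq_card => w; rewrite !finset.inE. Qed.

Lemma leq_count_words_cat m n p q r :
  (forall u v, size u = m -> size v = n -> p (u ++ v) -> q u && r v) ->
  count_words (m + n) p <= count_words m q * count_words n r.
Proof.
move=> pqr; rewrite count_words_cat (count_wordsE m) big_distrl /=.
apply: leq_sum => u _; case qu: (q u).
  rewrite mul1n; apply: leq_count_words => v nv /pqr.
  by rewrite qu size_tuple; apply.
rewrite mul0n leqn0 count_wordsE; apply/eqP; apply: big1 => v _.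
by case puv: (p _) => //; move: (pqr _ _ (size_tuple u) (size_tuple v) puv); rewrite qu.
Qed.

(** Each [u] is recovered from [x ++ u ++ y] as its middle block, so the chosen extensions are
    distinct words. Summing over [u] outermost counts one extension apiece. *)
Lemma geq_count_words_infix k m l p q :
  (forall u, size u = m -> q u ->
     exists x y, [/\ size x = k, size y = l & p (x ++ u ++ y)]) ->
  count_words m q <= count_words (k + (m + l)) p.
Proof.
move=> qp; rewrite count_words_cat.
under eq_bigr do rewrite count_words_cat.
rewrite exchange_big /= count_wordsE; apply: leq_sum => u _.
case qu: (q u) => //.
have [x [y [/eqP xk /eqP yl pw]]] := qp _ (size_tuple u) qu.
rewrite (bigD1 (Tuple xk)) //= count_wordsE (bigD1 (Tuple yl)) //= pw.
by rewrite -addnA.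
Qed.

(** All bridges have length [k], so [u] and [v] are the outer blocks of the word, and distinct pairs
    give distinct words whatever bridges are chosen. *)
Lemma geq_count_words_bridge m k n p q r :
  (forall u v, size u = m -> size v = n -> q u -> r v ->
     exists2 x, size x = k & p (u ++ x ++ v)) ->
  count_words m q * count_words n r <= count_words (m + (k + n)) p.
Proof.
move=> qrp; rewrite count_words_cat (count_wordsE m) big_distrl /=.
apply: leq_sum => u _; case qu: (q u); rewrite ?mul0n // mul1n.
rewrite count_words_cat count_wordsE.
under [X in _ <= X]eq_bigr do rewrite count_wordsE.
rewrite exchange_big /=; apply: leq_sum => v _; case rv: (r v) => //.
have [x /eqP xk pw] := qrp _ _ (size_tuple u) (size_tuple v) qu rv.
by rewrite (bigD1 (Tuple xk)) //= pw.
Qed.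

End CountWords.

(** * Paths in the automaton and its accessible part *)

Section AutomatonPaths.
Variables (S : finType) (A : fsa S).
Implicit Types (B : {set state A}) (p q : state A) (u v w : seq S).
Local Open Scope nat_scope.

Lemma run_cat q u v : run q (u ++ v) = run (run q u) v.
Proof. exact: foldl_cat. Qed.

Lemma run_within_cons B q s w :
  run_within B q (s :: w) = (q \in B) && run_within B (step q s) w.
Proof. by []. Qed.

Lemma run_within_cat B q u v :
  run_within B q (u ++ v) = run_within B q u && run_within B (run q u) v.
Proof.
elim: u q => [|s u IH] q /=; last by rewrite !run_within_cons IH andbA.
by rewrite /run_within /= andbT; case: (q \in B).
Qed.

Lemma run_within_start B q w : run_within B q w -> q \in B.
Proof. by case/andP. Qed.

Lemma run_within_end B q w : run_within B q w -> run q w \in B.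
Proof.
by rewrite -{1}[w]cats0 run_within_cat => /andP[_ /run_within_start].
Qed.

Lemma run_within_pow B q u n : run_within B q u -> run q u = q ->
  run_within B q (word_pow u n) /\ run q (word_pow u n) = q.
Proof.
move=> qu ruq; elim: n => [|n [IH1 IH2]].
  by split=> //; rewrite /run_within /= (run_within_start qu).
by rewrite /word_pow /= -/(word_pow u n) run_within_cat run_cat ruq qu.
Qed.

Lemma run_fail w : run (fail A) w = fail A.
Proof. by elim: w => //= s w; rewrite fail_loops. Qed.

Lemma run_neq_start p s w : run p (s :: w) != start A.
Proof.
by elim/last_ind: w => [|w t _] /=; rewrite -?cats1 ?run_cat /=; apply: start_not_target.
Qed.

Lemma fail_notin_accessible : fail A \notin accessible A.
Proof. by rewrite finset.inE eqxx. Qed.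

Lemma accessible_step p s :
  p \in accessible A -> step p s != fail A -> step p s \in accessible A.
Proof.
rewrite !finset.inE => /andP[_ /forallP pP] -> /=; apply/forallP => p'.
apply/implyP => p'N; have /implyP/(_ p'N) p'p := pP p'.
by apply: connect_trans p'p (connect1 _); apply/existsP; exists s.
Qed.

Lemma accessible_run_within p w :
  p \in accessible A -> run p w != fail A -> run_within (accessible A) p w.
Proof.
elim: w p => [|s w IH] p pA /=; first by rewrite /run_within /= pA.
rewrite run_within_cons pA => wN; apply: IH => //.
by apply: accessible_step => //; apply: contra wN => /eqP->; rewrite run_fail.
Qed.

(** No edge enters the start state. The end [q] of a nonempty loop is therefore a different state,
    and this non-fail state cannot reach the start. *)
Lemma start_notin_accessible q u : run_within (accessible A) q u ->
  run q u = q -> u != [::] -> start A \notin accessible A.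
Proof.
case: u => // s u qu ruq _.
have qS : q != start A by rewrite -{1}ruq; apply: run_neq_start.
have qN : q != fail A.
  by apply: contraNneq fail_notin_accessible => <-; apply: run_within_start qu.
rewrite finset.inE negb_and; apply/orP; right.
rewrite negb_forall; apply/existsP; exists q; rewrite qN /=.
apply/negP => /connectP[c + /esym cS].
elim/last_ind: c cS => [/eqP|c p _]; first by rewrite (negPf qS).
rewrite last_rcons => ->; rewrite rcons_path => /andP[_ /existsP[t]].
by rewrite (negPf (start_not_target _ _)).
Qed.

(** The predicate counted by [num_readable]: by conversion, [num_readable B n] is
    [count_words n (readable B)]. *)
Definition readable (B : {set state A}) : pred (seq S) :=
  fun w => [exists q, run_within B q w].

Lemma readable_catl B u v : readable B (u ++ v) -> readable B u.
Proof.
by case/existsP=> q; rewrite run_within_cat => /andP[qu _]; apply/existsP; exists q.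
Qed.

Lemma readable_catr B u v : readable B (u ++ v) -> readable B v.
Proof.
case/existsP=> q; rewrite run_within_cat => /andP[_ quv].
by apply/existsP; exists (run q u).
Qed.

(** Non-failing steps preserve accessibility, so a path crosses over at most once. The letter at
    index [i] labels the crossing edge and belongs to neither piece. *)
Lemma remainder_or_accessible p w : p \in remainder A -> run p w != fail A ->
  run_within (remainder A) p w \/
  exists2 i, i < size w &
    run_within (remainder A) p (take i w) /\ readable (accessible A) (drop i.+1 w).
Proof.
elim: w p => [|s w IH] p pR /= wN; first by left; rewrite /run_within /= pR.
have sN : step p s != fail A by apply: contra wN => /eqP->; rewrite run_fail.
have [sA|sA] := boolP (step p s \in accessible A).
  right; exists 0 => //=; rewrite drop0 /run_within /= pR; split=> //.
  by apply/existsP; exists (step p s); apply: accessible_run_within.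
have sR : step p s \in remainder A.
  by rewrite finset.inE finset.in_setU1 negb_or sN sA.
have [sw|[i iw [si di]]] := IH _ sR wN; [left|right].
  by rewrite run_within_cons pR.
by exists i.+1 => //; rewrite /= run_within_cons pR.
Qed.

Lemma num_readable_subadditive B m n :
  num_readable B (m + n) <= num_readable B m * num_readable B n.
Proof.
apply: (@leq_count_words_cat _ _ _ (readable B) (readable B) (readable B)).
by move=> u v _ _ uv; rewrite (readable_catl uv) (readable_catr uv).
Qed.

(** Union bound over the index [i] of the crossing edge; the factor [#|S|] counts the letter on that
    edge. *)
Lemma num_accepted_le n : start A \notin accessible A ->
  count_words n (accepts A) <= num_readable (remainder A) n +
    \sum_(i < n) num_readable (remainder A) i *
                 (#|S| * num_readable (accessible A) (n - i.+1)).
Proof.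
move=> SA.
pose R := remainder A.
pose p (i : nat) w := readable R (take i w) && readable (accessible A) (drop i.+1 w).
apply: (@leq_trans (count_words n (fun w => readable R w || [exists i : 'I_n, p i w]))).
  apply: leq_count_words => w wn; rewrite /accepts => wA.
  have wN : run (start A) w != fail A.
    by apply: contraTneq wA => ->; apply: fail_not_accept.
  have SR : start A \in R.
    rewrite finset.inE finset.in_setU1 negb_or SA andbT.
    by apply: contra wN => /eqP ->; rewrite run_fail.
  have [sw|[i iw [si di]]] := remainder_or_accessible SR wN; apply/orP; [left|right].
    by apply/existsP; exists (start A).
  rewrite wn in iw; apply/existsP; exists (Ordinal iw); rewrite /p /= di andbT.
  by apply/existsP; exists (start A).
apply: leq_trans (leq_count_words_or _ _ _) _; rewrite leq_add2l.
apply: leq_trans (leq_count_words_ex _ _ _) _; apply: leq_sum => -[i /= ilt] _.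
have nE : n = i + (1 + (n - i.+1)) by lia.
rewrite {1}nE.
apply: leq_trans (@leq_count_words_cat _ _ _ _ (readable R)
  (fun w => readable (accessible A) (behead w)) _) _.
  move=> u v ui _; rewrite /p take_size_cat ?drop_cat ?ui // ltnNge leqnSn /=.
  by rewrite subSnn drop1.
rewrite leq_mul2l; apply/orP; right.
apply: leq_trans (@leq_count_words_cat _ _ _ _ xpredT (readable (accessible A)) _) _.
  by case=> [|s [|]] //.
by rewrite count_wordsT expn1.
Qed.

End AutomatonPaths.

(** * Consequences of recurrence *)

Section RecurrentAccessible.
Variables (S : finType) (A : fsa S).
Local Open Scope nat_scope.
(** Recurrence leaves out the start and fail states; neither is accessible here, so the restriction
    disappears. *)
Lemma recurrent_connected : start A \notin accessible A -> recurrent (accessible A) ->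
  exists L, forall p q, p \in accessible A -> q \in accessible A ->
    exists w, [/\ size w = L, run_within (accessible A) p w & run p w = q].
Proof.
move=> SA [L recL]; exists L => p q pA qA.
suff sub t : t \in accessible A -> t \in accessible A :\: [set start A; fail A]%SET.
  by apply: recL; apply: sub.
move=> tA; rewrite finset.in_setD tA andbT finset.in_set2 negb_or.
apply/andP; split; apply: contraNneq SA => tE; first by rewrite -tE.
by move: tA; rewrite tE (negPf (fail_notin_accessible A)).
Qed.

Variable L : nat.
Hypothesis connL : forall p q, p \in accessible A -> q \in accessible A ->
  exists w, [/\ size w = L, run_within (accessible A) p w & run p w = q].

Lemma num_readable_supmultiplicative m n :
  num_readable (accessible A) m * num_readable (accessible A) n <=
    num_readable (accessible A) (m + (L + n)).
Proof.
apply: (@geq_count_words_bridge _ _ _ _ (readable (accessible A))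
  (readable (accessible A)) (readable (accessible A))).
move=> u v _ _ /existsP[p pu] /existsP[q qv].
have [x [xL px xq]] := connL (run_within_end pu) (run_within_start qv).
by exists x => //; apply/existsP; exists p; rewrite !run_within_cat pu px xq.
Qed.

(* As [w0] and [w0 ++ w0] end in the same state, [w0] also labels a loop at that
   state; hence so does [w0 ++ v]. *)
Lemma rigid_cat (w0 v : seq S) : accepts A w0 ->
  run (start A) w0 = run (start A) (word_pow w0 2) ->
  run (run (start A) w0) v = run (start A) w0 -> rigid A (w0 ++ v).
Proof.
rewrite /word_pow /= cats0 run_cat => aw0 loop0 loopv [//|n] _.
rewrite /accepts /word_pow /= !run_cat loopv.
suff -> : run (run (start A) w0) (flatten (nseq n (w0 ++ v))) = run (start A) w0 by [].
by elim: n => //= n IH; rewrite !run_cat -loop0 loopv.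
Qed.

Definition rigid_through (U w : seq S) : Prop :=
  rigid A w /\ exists w1 w2, w = w1 ++ U ++ w2.

Lemma num_rigid_through (w0 U : seq S) q : accepts A w0 ->
  run (start A) w0 = run (start A) (word_pow w0 2) ->
  run (start A) w0 \in accessible A ->
  run_within (accessible A) q U ->
  exists D, forall m, num_readable (accessible A) m <=
    count_words (D + m) (fun w => `[< rigid_through U w >]).
Proof.
move=> aw0 loop0 accE qU.
(* The word built below is [w0 ++ z ++ U ++ x ++ u ++ y], with connecting words [z], [x], [y] of
   length [L]; [D] is the length of all but [u]. *)
exists (size w0 + (L + (size U + L)) + L) => m.
rewrite addnAC -addnA; apply: (@geq_count_words_infix _ _ _ _ _ (readable (accessible A))).
move=> u _ /existsP[p pu].
have [z [zL zE zq]] := connL accE (run_within_start qU).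
have [x [xL xq xp]] := connL (run_within_end qU) (run_within_start pu).
have [y [yL yp yE]] := connL (run_within_end pu) accE.
exists (w0 ++ z ++ U ++ x), y; split=> //; first by rewrite !size_cat zL xL.
apply/asboolP; split; last first.
  by exists (w0 ++ z), (x ++ u ++ y); rewrite -!catA.
by rewrite -catA; apply: rigid_cat => //; rewrite !run_cat zq xp yE.
Qed.

End RecurrentAccessible.

(** * Exponential growth rates *)

Section GrowthRate.
Variable R : realType.
Implicit Types (a r f : nat -> nat) (x y rho sigma C K : R).

Lemma limn_esup_lt (u : nat -> \bar R) (x : R) : (limn_esup u < x%:E)%E ->
  exists N, forall n, (N <= n)%N -> (u n < x%:E)%E.
Proof.
rewrite /limn_esup limf_esupE => /ereal_inf_lt[_ [V [N _ NV] <-] ltx].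
exists N => n Nn; apply: le_lt_trans ltx; apply: ereal_sup_ubound.
by exists n => //; apply: NV.
Qed.

Lemma limn_esup_le (u : nat -> \bar R) (y : \bar R) N :
  (forall n, (N <= n)%N -> (u n <= y)%E) -> (limn_esup u <= y)%E.
Proof.
move=> uy; rewrite /limn_esup limf_esupE.
apply: (@le_trans _ _ (ereal_sup (u @` [set n | (N <= n)%N]))).
  by apply: ereal_inf_lbound; exists [set n | (N <= n)%N] => //; exists N.
by apply: ge_ereal_sup => _ [n Nn <-]; apply: uy.
Qed.

Lemma limn_einf_ge (u : nat -> \bar R) (y : \bar R) N :
  (forall n, (N <= n)%N -> (y <= u n)%E) -> (y <= limn_einf u)%E.
Proof.
move=> uy; rewrite /limn_einf leeNr; apply: (@limn_esup_le _ _ N) => n Nn.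
by rewrite leeN2 uy.
Qed.

Lemma growth_rate_ge0 a : (0 <= growth_rate R a)%E.
Proof.
by apply: limf_esup_ge0 => [[N _ /(_ N)]|n]; [apply=> /= | rewrite lee_fin powR_ge0].
Qed.

Lemma rootn_lt_expr (b x : R) n : (0 < n)%N -> 0 <= b -> 0 <= x ->
  (b `^ n%:R^-1 < x) = (b < x ^+ n).
Proof.
move=> n0 b0 x0; have n0' : n%:R != 0 :> R by rewrite pnatr_eq0 -lt0n.
have bE : b = (b `^ n%:R^-1) ^+ n.
  by rewrite -powR_mulrn ?powR_ge0 // -powRrM mulVf // powRr1.
by rewrite [in RHS]bE ltr_pXn2r // nnegrE powR_ge0.
Qed.

(** For large [n] the bound holds with constant 1; [C] absorbs the finitely many initial ratios
    [a i / x ^+ i]. *)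
Lemma growth_rate_lt a x : (growth_rate R a < x%:E)%E ->
  exists2 C, 0 < C & forall n, (a n)%:R <= C * x ^+ n.
Proof.
move=> ax; have x0 : 0 < x by rewrite -lte_fin (le_lt_trans (growth_rate_ge0 a)).
have [N NP] := limn_esup_lt ax.
pose b i := (a i)%:R / x ^+ i.
have b0 i : 0 <= b i by rewrite divr_ge0 // exprn_ge0 // ltW.
exists (1 + \sum_(i < N.+1) b i) => [|n].
  by rewrite ltr_pwDl // sumr_ge0.
rewrite -ler_pdivrMr ?exprn_gt0 //.
have [nN|Nn] := leqP n N.
  rewrite (bigD1 (Ordinal (nN : (n < N.+1)%N))) //= addrCA lerDl.
  by rewrite addr_ge0 // sumr_ge0.
apply: (@le_trans _ _ 1); last by rewrite lerDl sumr_ge0.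
have := NP n (ltnW Nn).
rewrite lte_fin rootn_lt_expr ?(leq_trans _ Nn) ?(ltW x0) // => /ltW anx.
by rewrite ler_pdivrMr ?exprn_gt0 // mul1r.
Qed.

(** The gap between [x] and [y] absorbs [C]: as [(x / y) ^+ n] tends to 0, eventually
    [C * x ^+ n < y ^+ n]. *)
Lemma growth_rate_le a x y C : 0 < x -> x < y ->
  (forall n, (a n)%:R <= C * x ^+ n) -> (growth_rate R a <= y%:E)%E.
Proof.
move=> x0 xy aC; have y0 := lt_trans x0 xy.
have /cvgrPdist_lt/(_ (`|C| + 1)^-1) : (fun n => (x / y) ^+ n) @ \oo --> 0.
  by apply: cvg_expr; rewrite ger0_norm ?divr_ge0 ?ltW // ltr_pdivrMr // mul1r.
have C0 : 0 < `|C| + 1 by rewrite ltr_wpDl.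
rewrite invr_gt0 C0 => /(_ isT)[N _ NP].
apply: (@limn_esup_le _ _ N.+1) => n Nn; rewrite lee_fin ltW //.
rewrite rootn_lt_expr ?(ltW y0) ?(leq_trans _ Nn) //.
have := NP n (ltnW Nn).
rewrite /= sub0r normrN ger0_norm ?exprn_ge0 ?divr_ge0 ?ltW // expr_div_n.
rewrite ltr_pdivrMr ?exprn_gt0 // mulrC ltr_pdivlMr // => lt.
apply: le_lt_trans (aC n) (le_lt_trans _ lt).
rewrite mulrC ler_wpM2l ?exprn_ge0 ?(ltW x0) //.
by apply: le_trans (ler_norm C) _; rewrite lerDl.
Qed.

(* One half of Fekete's lemma: the growth rate of a submultiplicative sequence
   is the infimum of the [n]-th roots. *)
Lemma submultiplicative_growth a x : a 0%N = 1%N ->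
  (forall m n, a (m + n) <= a m * a n)%N ->
  0 < x -> (x%:E < growth_rate R a)%E -> forall n, x ^+ n <= (a n)%:R.
Proof.
move=> a0 sub x0 xlt k; rewrite leNgt; apply/negP => ak.
(* [growth_rate_le] only gives bounds above the base [x], hence the intermediate [y]; the growth
   rate may be infinite. *)
have [y xy ylt] : exists2 y, x < y & (y%:E < growth_rate R a)%E.
  case: (growth_rate R a) xlt => [z| |] //.
    rewrite lte_fin => xz; exists ((x + z) / 2); rewrite ?lte_fin; lra.
  by move=> _; exists (x + 1); rewrite ?ltrDl // ltry.
have k0 : (0 < k)%N by case: k ak => //; rewrite a0 expr0 ltxx.
suff [C aC] : exists C, forall n, (a n)%:R <= C * x ^+ n.
  by have := growth_rate_le x0 xy aC; rewrite leNgt ylt.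
pose b i := (a i)%:R / x ^+ i.
have b0 i : 0 <= b i by rewrite divr_ge0 // exprn_ge0 // ltW.
(* Blocks of length [k] are peeled off, each costing a factor below [x ^+ k]; the sum covers the
   remaining lengths below [k]. *)
exists (\sum_(i < k) b i); elim/ltn_ind => n IH.
have [kn|nk] := leqP k n.
  rewrite -(subnKC kn) exprD mulrCA.
  apply: (@le_trans _ _ ((a k)%:R * (a (n - k)%N)%:R)); first by rewrite -natrM ler_nat.
  by apply: ler_pM => //; [apply: ltW | apply: IH; lia].
rewrite -ler_pdivrMr ?exprn_gt0 // (bigD1 (Ordinal nk)) //= lerDl.
by rewrite sumr_ge0.
Qed.

Lemma geometric_sum_le (q : R) n : 0 <= q < 1 ->
  \sum_(i < n) q ^+ i <= (1 - q)^-1.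
Proof.
move=> /andP[q0 q1]; rewrite -[leRHS]div1r ler_pdivlMr ?subr_gt0 //.
have -> : (\sum_(i < n) q ^+ i) * (1 - q) = 1 - q ^+ n.
  by rewrite -opprB mulrN mulrC -subrX1 opprB.
by rewrite gerBl exprn_ge0.
Qed.

(** From [sigma ^+ i.+1 <= a i.+1] follows [a (n - i.+1) <= K * a n / sigma ^+ i.+1]. The [i]-th
    term is thus at most a constant times [a n * (rho / sigma) ^+ i], and the geometric series is
    bounded. *)
Lemma convolution_le a r f K C rho sigma (s : nat) :
  0 < rho -> rho < sigma -> 0 < C ->
  (forall n, (r n)%:R <= C * rho ^+ n) ->
  (forall n, sigma ^+ n <= (a n)%:R) ->
  (forall m n, (a m)%:R * (a n)%:R <= K * (a (m + n)%N)%:R) ->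
  (forall n, (f n <= r n + \sum_(i < n) r i * (s * a (n - i.+1)))%N) ->
  exists2 K' : R, 0 < K' & forall n, (f n)%:R <= K' * (a n)%:R.
Proof.
move=> rho0 rs C0 rC sa aK fr; have s0 := lt_trans rho0 rs.
have a0 n : 0 < (a n)%:R :> R by apply: lt_le_trans (sa n); apply: exprn_gt0.
have K0 : 0 < K.
  have : 0 < K * (a (0 + 0)%N)%:R by apply: lt_le_trans (aK 0 0)%N; apply: mulr_gt0.
  by rewrite pmulr_lgt0.
pose q := rho / sigma.
have q01 : 0 <= q < 1 by rewrite divr_ge0 ?ltW //= ltr_pdivrMr // mul1r.
have q1 : 0 < (1 - q)^-1 by rewrite invr_gt0 subr_gt0; case/andP: q01.
have B0 : 0 <= C * s%:R * K / sigma by rewrite !mulr_ge0 ?invr_ge0 // ltW.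
exists (C + C * s%:R * K / sigma * (1 - q)^-1) => [|n].
  by rewrite ltr_pwDl // mulr_ge0 // ltW.
apply: le_trans (_ : (r n + \sum_(i < n) r i * (s * a (n - i.+1)))%N%:R <= _).
  by rewrite ler_nat.
rewrite natrD mulrDl; apply: lerD.
  apply: le_trans (rC n) _; rewrite ler_pM2l //; apply: le_trans (sa n).
  by apply: lerXn2r; rewrite ?nnegrE ltW.
rewrite natr_sum.
have le_i (i : 'I_n) : (r i * (s * a (n - i.+1)))%N%:R <=
    C * s%:R * K / sigma * (a n)%:R * q ^+ i.
  have ai : (a (n - i.+1)%N)%:R <= K * (a n)%:R / sigma ^+ i.+1.
    rewrite ler_pdivlMr ?exprn_gt0 //.
    apply: (@le_trans _ _ ((a (n - i.+1)%N)%:R * (a i.+1)%:R)); first by rewrite ler_pM2l.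
    by apply: le_trans (aK _ _) _; rewrite subnK.
  rewrite !natrM.
  apply: le_trans (_ : (C * rho ^+ i) * (s%:R * (K * (a n)%:R / sigma ^+ i.+1)) <= _).
    by apply: ler_pM => //; rewrite ?mulr_ge0 // ler_wpM2l.
  rewrite le_eqVlt; apply/orP; left; apply/eqP.
  rewrite /q expr_div_n exprS; field.
  by rewrite expf_neq0 ?gt_eqF.
apply: le_trans (_ : \sum_(i < n) C * s%:R * K / sigma * (a n)%:R * q ^+ i <= _).
  by apply: ler_sum => i _; apply: le_i.
rewrite -mulr_sumr [leRHS]mulrAC ler_wpM2l ?geometric_sum_le //.
by rewrite mulr_ge0 // ltW.
Qed.

End GrowthRate.

(** The first [D] terms are absorbed by the summand [a 0], which is at least 1, and the others by
    [a (D + i) <= a D * a i]. *)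
Lemma sum_shift_le (a : nat -> nat) D : (0 < a 0)%N ->
  (forall m n, a (m + n) <= a m * a n)%N ->
  exists K, forall l, (D <= l)%N ->
    (\sum_(n < l.+1) a n <= K * \sum_(m < (l - D).+1) a m)%N.
Proof.
move=> a0 sub; exists (\sum_(n < D) a n + a D)%N => l Dl.
have -> : (l.+1 = D + (l - D).+1)%N by rewrite addnS subnKC.
rewrite big_split_ord /= mulnDl leq_add //.
  by rewrite leq_pmulr // big_ord_recl /= ltn_addr.
by rewrite big_distrr /=; apply: leq_sum => i _; apply: sub.
Qed.

(** * Quasi-additive sequences *)

Section QuasiAdditive.
Variables (R : realType) (d : nat -> R) (K : R).
Hypothesis d0 : d 0%N = 0.
Hypothesis dK : forall m n, `|d (m + n)%N - d m - d n| <= K.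

Lemma quasi_additive_mul m n : `|d (m * n)%N - m%:R * d n| <= m%:R * K.
Proof.
elim: m => [|m IH]; first by rewrite mul0n d0 !mul0r subr0 normr0.
rewrite mulSn -natr1 !mulrDl !mul1r.
have -> : d (n + m * n)%N - (m%:R * d n + d n) =
  (d (n + m * n)%N - d n - d (m * n)%N) + (d (m * n)%N - m%:R * d n) by ring.
by rewrite addrC; apply: le_trans (ler_normD _ _) (lerD IH (dK _ _)).
Qed.

(** Both slopes are compared with the slope at the common multiple [m * n]. *)
Lemma quasi_additive_slope m n : (0 < m)%N -> (0 < n)%N ->
  `|d m / m%:R - d n / n%:R| <= K / m%:R + K / n%:R.
Proof.
move=> m0 n0; have m0' : 0 < m%:R :> R by rewrite ltr0n.
have n0' : 0 < n%:R :> R by rewrite ltr0n.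
have mn0 : 0 < m%:R * n%:R :> R by rewrite mulr_gt0.
rewrite -(ler_pM2l mn0) -{1}[m%:R * n%:R]gtr0_norm // -normrM.
have -> : m%:R * n%:R * (d m / m%:R - d n / n%:R) =
    (d (m * n)%N - m%:R * d n) - (d (n * m)%N - n%:R * d m).
  by rewrite (mulnC n); field; rewrite !gt_eqF.
have -> : m%:R * n%:R * (K / m%:R + K / n%:R) = m%:R * K + n%:R * K.
  by field; rewrite !gt_eqF.
apply: le_trans (ler_normB _ _) _.
by apply: lerD; apply: quasi_additive_mul.
Qed.

Lemma quasi_additive_cvg :
  exists2 c, d 1%N - K <= c & d n / n%:R @[n --> \oo] --> c.
Proof.
have K0 : 0 <= K by apply: le_trans (normr_ge0 _) (dK 0 0).
have cvgd : cvg (d n / n%:R @[n --> \oo]).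
  apply/cauchy_cvgP/cauchy_exP => e e0.
  have [N NP] : exists N, forall n, (N <= n)%N -> (0 < n)%N && (K / n%:R < e / 2).
    exists (Num.truncn (K / (e / 2))).+1 => n Nn.
    have n0 : (0 < n)%N by apply: leq_trans Nn.
    rewrite n0 ltr_pdivrMr ?ltr0n // mulrC -ltr_pdivrMr ?divr_gt0 //.
    by apply: lt_le_trans (truncnS_gt _) _; rewrite ler_nat.
  exists (d N / N%:R); exists N => // n Nn.
  have /andP[n0 nK] := NP n Nn; have /andP[N0 NK] := NP N (leqnn _).
  rewrite /ball /=; apply: le_lt_trans (quasi_additive_slope N0 n0) _.
  by rewrite [ltRHS]splitr ltrD.
exists (lim (d n / n%:R @[n --> \oo])) => //.
(* Splitting [n] into [n] unit steps gives [d n >= n * (d 1 - K)], so every slope is at least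
   [d 1 - K]. *)
apply: limr_ge => //; exists 1%N => // n n0.
have n0' : 0 < n%:R :> R by rewrite ltr0n.
rewrite ler_pdivlMr // mulrBl.
have := quasi_additive_mul n 1; rewrite muln1 ler_norml => /andP[+ _].
rewrite mulrC [K * _]mulrC; lra.
Qed.

End QuasiAdditive.

(** * The action of words on the space *)

Section WordAction.
Variables (R : realType) (C : category) (X : metricType R).
Variables (act : arr C -> X -> X) (S : finType) (letter : S -> arr C).
Hypothesis actP : isometric_action act.

(** Acting letter by letter requires no composability, so powers of a loop word act even if the
    source and target of its arrow differ. *)
Definition act_word (w : seq S) (y : X) : X := foldr (fun s => act (letter s)) y w.

Lemma act_word_cat u v y : act_word (u ++ v) y = act_word u (act_word v y).
Proof. exact: foldr_cat. Qed.

Lemma act_word_pow w n y : act_word (word_pow w n) y = iter n (act_word w) y.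
Proof. by elim: n => //= n <-; rewrite act_word_cat. Qed.

Lemma act_word_isometry w y z : mdist (act_word w y) (act_word w z) = mdist y z.
Proof. by elim: w => //= s w <-; case: (act_isometry actP (letter s)) => _ ->. Qed.

Lemma act_idc x y : act (idc x) y = y.
Proof.
have [/bij_inj inj _] := act_isometry actP (idc x).
apply: inj; rewrite -(act_comp actP); last by rewrite tgt_idc src_idc.
by rewrite -{1}(src_idc x) comp_idl.
Qed.

Lemma src_word_arrow x w : word_defined letter x w -> src (word_arrow letter x w) = x.
Proof.
elim: w x => [|s w IH] x /=; first by rewrite src_idc.
by move=> [sx /IH ws]; rewrite src_comp ?ws.
Qed.

Lemma act_word_arrow x w y : word_defined letter x w ->
  act (word_arrow letter x w) y = act_word w y.
Proof.
elim: w x => [|s w IH] x /=; first by rewrite act_idc.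
move=> [_ wd]; rewrite (act_comp actP) ?src_word_arrow //.
by rewrite IH.
Qed.

Lemma word_defined_take x w k : word_defined letter x w -> word_defined letter x (take k w).
Proof.
by elim: w x k => [|s w IH] x [|k] //= [? /IH wd].
Qed.

End WordAction.

(** A point [c t] of the geodesic splits the distance exactly, and replacing it by [z] costs at most
    [r] on each side. *)
Lemma geodesic_dist (R : realType) (X : metricType R) (r : R) (x y z : X) c :
  is_geodesic x y c -> in_nbhd r (geodesic_image x y c) z ->
  mdist x z + mdist z y <= mdist x y + 2 * r.
Proof.
move=> [c0 c1 ciso] [_ [t /= + <-] zr].
rewrite in_itv /= => /andP[t0 t1]; have d0 := mdist_ge0 x y.
have xt : mdist x (c t) = t.
  by rewrite -{1}c0 ciso ?lexx ?d0 ?t0 // sub0r normrN ger0_norm.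
have ty : mdist (c t) y = mdist x y - t.
  by rewrite -{1}c1 ciso ?lexx ?d0 ?t0 ?t1 // distrC ger0_norm // subr_ge0.
have := metric_triangle x (c t) z; have := metric_triangle z (c t) y.
rewrite xt ty [mdist (c t) z]metric_sym; lra.
Qed.

(** * Displacements along normal forms *)

Section GeodesicWords.
Variables (R : realType) (C : category) (o : ob C) (G : set (arr C)).
Variables (X : metricType R) (act : arr C -> X -> X) (P : X).
Variables (S : finType) (letter : S -> arr C) (A : fsa S) (nf : arr C -> seq S).
Hypotheses (actP : isometric_action act) (geoX : geodesic_space X).
Hypothesis nfP : automatic_normal_form R o G letter A nf.

Lemma accepted_arrow w : accepts A w ->
  [/\ word_defined letter o w, G (word_arrow letter o w) & nf (word_arrow letter o w) = w].
Proof.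
move=> /(nf_recognized nfP)[g Gg gw].
by have [] := nf_represents nfP Gg; rewrite gw => wd ->.
Qed.

Local Notation aw := (act_word act letter).

Lemma geodesic_words_dist : geodesic_words o G act P letter nf ->
  exists2 r : R, 0 <= r & forall u v w z, accepts A (u ++ v ++ w ++ z) ->
    mdist P (aw v P) + mdist P (aw w P) <= mdist P (aw (v ++ w) P) + 2 * r.
Proof.
move=> [r r0 gw]; exists r => // u v w z ax.
have [wd Gx nfx] := accepted_arrow ax.
(* The geodesic words hypothesis requires [i < j], so an empty infix is treated apart. *)
have [v0|vn] := eqVneq (size v + size w)%N 0%N.
  move/eqP: v0; rewrite addn_eq0 !size_eq0 => /andP[/eqP-> /eqP->] /=.
  by rewrite mdistxx !add0r mulr_ge0.
have := gw _ Gx (size u) (size u + (size v + size w))%N (size u + size v)%N.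
rewrite nfx !size_cat.
have -> : (size u < size u + (size v + size w) <= size u + (size v + (size w + size z)))%N.
  by lia.
have -> : (size u <= size u + size v <= size u + (size v + size w))%N by lia.
have orbE k : orbit_point o act P letter (u ++ v ++ w ++ z) k =
    aw (take k (u ++ v ++ w ++ z)) P.
  by rewrite /orbit_point act_word_arrow //; apply: word_defined_take.
have e1 : take (size u) (u ++ v ++ w ++ z) = u by rewrite take_size_cat.
have e2 : take (size u + size v) (u ++ v ++ w ++ z) = u ++ v.
  by rewrite catA take_size_cat ?size_cat.
have e3 : take (size u + (size v + size w)) (u ++ v ++ w ++ z) = u ++ v ++ w.
  by rewrite (catA v) catA take_size_cat ?size_cat //.
rewrite !orbE e1 e2 e3 => /(_ isT isT) near.
(* The prefixes [u] and [u ++ v] act by isometries and cancel, which leaves displacements of [P]. *)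
have [c gc] := geoX (aw u P) (aw (u ++ v ++ w) P).
have := geodesic_dist gc (near c gc).
by rewrite !act_word_cat !(act_word_isometry _ actP).
Qed.

(* A rigid element either moves [P] by at most [2 * r] or is loxodromic, since
   the displacements of its powers are additive up to [2 * r]. *)
Lemma rigid_through_loxodromic : geodesic_words o G act P letter nf ->
  exists r : R, forall U w, r < mdist P (aw U P) -> rigid_through A U w ->
    loxodromic P (act (word_arrow letter o w)).
Proof.
move=> gw; have [r r0 rP] := geodesic_words_dist gw.
(* Cutting off [w2] and then [w1] costs [2 * r] each, so the displacement of [w] exceeds
   [6 * r - 4 * r], the defect [2 * r] of additivity. *)
exists (6 * r) => U w lU [rig [w1 [w2 wE]]].
have aw0 : accepts A w.
  by have := rig 1%N isT; rewrite /word_pow /= cats0.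
have [wd _ _] := accepted_arrow aw0.
have iterE n : iter n (act (word_arrow letter o w)) P = aw (word_pow w n) P.
  by rewrite act_word_pow; apply: eq_iter => y; apply: act_word_arrow.
pose d n := mdist P (aw (word_pow w n) P).
have d0 : d 0%N = 0 by rewrite /d mdistxx.
have powD m n : word_pow w (m + n) = word_pow w m ++ word_pow w n.
  by rewrite /word_pow nseqD flatten_cat.
(* The upper bound is the triangle inequality. The lower one uses that the power [m + n] is
   accepted, which rigidity gives for positive exponents only. *)
have dK m n : `|d (m + n)%N - d m - d n| <= 2 * r.
  rewrite ler_norml; apply/andP; split; last first.
    have : d (m + n)%N <= d m + d n; last lra.
    rewrite /d powD act_word_cat; apply: le_trans (metric_triangle _ (aw (word_pow w m) P) _) _.
    by rewrite lerD2l act_word_isometry.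
  have [|mn0] := posnP (m + n)%N.
    by move=> /eqP; rewrite addn_eq0 => /andP[/eqP-> /eqP->]; rewrite d0; lra.
  have := rP [::] (word_pow w m) (word_pow w n) [::].
  rewrite cats0 /= -powD => /(_ (rig _ mn0)); rewrite -/(d _) -/(d _) -/(d _); lra.
have [c cge cvgc] := quasi_additive_cvg d0 dK.
exists c; last by under eq_fun do rewrite iterE.
apply: lt_le_trans cge; rewrite subr_gt0.
have d1 : d 1%N = mdist P (aw w P) by rewrite /d /word_pow /= cats0.
have := rP w1 U w2 [::]; rewrite cats0 -wE => /(_ aw0) h1.
have := rP [::] w1 (U ++ w2) [::]; rewrite /= cats0 -wE => /(_ aw0) h2.
have g1 := mdist_ge0 P (aw w1 P); have g2 := mdist_ge0 P (aw w2 P).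
rewrite d1; lra.
Qed.

End GeodesicWords.

(** From some index on, the displacement exceeds [c / 2 * n]. *)
Lemma loxodromic_unbounded (R : realType) (X : metricType R) (P : X) (f : X -> X) (r : R) :
  loxodromic P f -> exists n, r < mdist P (iter n f P).
Proof.
move=> [c c0 cvgc].
have c20 : 0 < c / 2 by rewrite divr_gt0.
move/cvgrPdist_lt: cvgc => /(_ _ c20)[N _ NP].
pose n := maxn N (Num.truncn (`|r| / (c / 2))).+1.
have n0 : 0 < n%:R :> R by rewrite ltr0n leq_max orbT.
exists n; have := NP n (leq_maxl _ _); rewrite /= ltr_norml => /andP[_].
rewrite ltrBlDr -ltrBlDl => h.
have {}h : c / 2 < mdist P (iter n f P) / n%:R by lra.
rewrite ltr_pdivlMr // in h; apply: lt_trans h.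
apply: le_lt_trans (ler_norm r) _; rewrite mulrC -ltr_pdivrMr //.
apply: lt_le_trans (truncnS_gt _) _.
by rewrite ler_nat leq_maxr.
Qed.

(** * Comparison of balls with accessible words *)

Lemma num_accepted_le_accessible (R : realType) (S : finType) (A : fsa S) :
  start A \notin accessible A -> dominated_by_accessible A R ->
  exists2 K : R, 0 < K & forall n,
    (count_words n (accepts A))%:R <= K * (num_readable (accessible A) n)%:R.
Proof.
move=> SA [/set0Pn[q qA] rec dom].
have [L connL] := recurrent_connected SA rec.
set a := num_readable (accessible A); set r := num_readable (remainder A) in dom *.
(* Domination leaves room for two rates: the points at one and two thirds of the gap if both growth
   rates are finite, [x + 1] and [x + 2] if the larger one is infinite. *)
have [rho [sigma [rlt rs alt]]] : exists rho sigma : R,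
    [/\ (growth_rate R r < rho%:E)%E, rho < sigma & (sigma%:E < growth_rate R a)%E].
  have := growth_rate_ge0 R r; case: (growth_rate R r) dom => [x| |] //.
    case: (growth_rate R a) => [y| |] // + _.
      rewrite lte_fin => xy; exists ((2 * x + y) / 3), ((x + 2 * y) / 3).
      by rewrite !lte_fin; split; lra.
    by move=> _; exists (x + 1), (x + 2); rewrite lte_fin ltry; split=> //; lra.
  by case: (growth_rate R a).
have rho0 : 0 < rho by rewrite -lte_fin (le_lt_trans (growth_rate_ge0 R r)).
have [C C0 rC] := growth_rate_lt rlt.
have a0 : a 0%N = 1%N.
  rewrite /a /num_readable -/(count_words 0 (readable (accessible A))) count_wordsE.
  rewrite (bigD1 [tuple]) //= big1 ?addn0 => [|w]; last by rewrite tuple0.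
  suff -> : readable (accessible A) [::] by [].
  by apply/existsP; exists q; rewrite /run_within /= qA.
have asub := @num_readable_subadditive _ _ (accessible A).
have sa := submultiplicative_growth a0 asub (lt_trans rho0 rs) alt.
(* The bridge of length [L] is removed again by submultiplicativity, at the price of the factor
   [a L]. *)
have aK m n : (a m)%:R * (a n)%:R <= (a L)%:R * (a (m + n)%N)%:R :> R.
  rewrite -!natrM ler_nat; apply: leq_trans (num_readable_supmultiplicative connL m n) _.
  by rewrite addnCA; apply: asub.
exact: (convolution_le rho0 rs C0 rC sa aK (fun n => num_accepted_le n SA)).
Qed.

(** Normal forms put each sphere in bijection with the accepted words of that length, and the ball
    is a disjoint union of spheres. *)
Lemma finite_card_ball (R : realType) (C : category) (o : ob C) (G : set (arr C))
    (S : finType) (letter : S -> arr C) (A : fsa S) (nf : arr C -> seq S)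
    (Q : set (arr C)) (l : nat) : automatic_normal_form R o G letter A nf ->
  finite_card (nf_ball G nf l `&` Q) = (\sum_(n < l.+1)
    count_words n (fun w => accepts A w && `[< Q (word_arrow letter o w) >]))%N.
Proof.
move=> nfP.
pose sphere n : set {classic (arr C)} := [set g | [/\ G g, size (nf g) = n & Q g]].
pose p w := accepts A w && `[< Q (word_arrow letter o w) >].
pose f n (w : n.-tuple S) : {classic (arr C)} := word_arrow letter o w.
pose W n := enum [set w : n.-tuple S | p w]%SET.
(* [fset_set] is empty on infinite sets, so the spheres are first exhibited as finite images. *)
have sphereE n : sphere n = [set` [fset f n w | w in W n]%fset].
  apply/seteqP; split=> [g [Gg /eqP gn Qg]|g /=].
    have [_ gE] := nf_represents nfP Gg.
    apply/imfsetP; exists (Tuple gn); last by rewrite /f /= gE.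
    rewrite /= /W mem_enum finset.inE /p /= gE; apply/andP; split; last exact/asboolP.
    by apply/(nf_recognized nfP); exists g.
  case/imfsetP => w /=; rewrite /W mem_enum finset.inE => /andP[aw /asboolP Qw] ->.
  by have [_ Gw nfw] := accepted_arrow nfP aw; rewrite /sphere /f /= nfw size_tuple.
have cardW n : #|` fset_set (sphere n)| = count_words n p.
  rewrite sphereE set_fsetK card_in_imfset => [|u v /=].
    rewrite /count_words cardE; apply: perm_size; apply: uniq_perm.
    - exact: enum_finmem_uniq.
    - exact: enum_uniq.
    - by move=> w; rewrite enum_finmemE.
  rewrite /W !mem_enum !finset.inE => /andP[au _] /andP[av _] /(congr1 nf).
  have [_ _ nfu] := accepted_arrow nfP au; have [_ _ nfv] := accepted_arrow nfP av.
  by rewrite /f nfu nfv => /val_inj.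
have -> : nf_ball G nf l `&` Q = \big[setU/set0]_(n < l.+1) sphere n.
  rewrite -bigcup_mkord; apply/seteqP; split=> [g [[Gg gl] Qg]|g [n /= nl [Gg gn Qg]]].
    by exists (size (nf g)).
  by split=> //; split=> //; rewrite gn.
rewrite /finite_card -trivIset_sum_card.
- by apply: eq_bigr => n _; rewrite cardW.
- by move=> n; rewrite sphereE; apply: finite_fset.
- by move=> i j _ _ [g [[_ <- _] [_ <- _]]].
Qed.

Theorem theorem2p10 (R : realType)
    (C : category) (o : ob C) (G : set (arr C))
    (X : metricType R) (delta : R) (act : arr C -> X -> X) (P : X)
    (S : finType) (letter : S -> arr C) (A : fsa S) (nf : arr C -> seq S) :
  submonoid_at o G ->
  geodesic_space X -> hyperbolic X delta ->
  isometric_action act ->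
  injective letter ->
  automatic_normal_form R o G letter A nf ->
  geodesic_words o G act P letter nf ->
  interesting_loxodromic act P letter A ->
  (0 < limn_einf (fun l : nat =>
     ((finite_card (nf_ball G nf l `&` rigid_loxodromic act P A nf))%:R
        / (finite_card (nf_ball G nf l))%:R : R)%:E))%E.
Proof.
move=> _ geoX _ actP _ nfP gw [q [u [x [qu ruq ud lox]]]].
have actE n : iter n (act (word_arrow letter x u)) P = act_word act letter (word_pow u n) P.
  by rewrite act_word_pow; apply: eq_iter => y; apply: act_word_arrow.
(* An empty loop would fix [P], contradicting loxodromy. *)
have uN : u != [::].
  apply/eqP => u0; have [n] := loxodromic_unbounded 0 lox.
  suff -> : iter n (act (word_arrow letter x u)) P = P by rewrite mdistxx ltxx.
  by rewrite actE u0; elim: n.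
have SA := start_notin_accessible qu ruq uN.
have [w0 [aw0 _ loop0 accE]] := nf_rigid nfP.
have [K1 K10 K1P] := num_accepted_le_accessible SA (nf_dominated nfP).
have [_ rec _] := nf_dominated nfP.
have [L connL] := recurrent_connected SA rec.
have [r rP] := rigid_through_loxodromic actP geoX nfP gw.
(* The power is chosen to move [P] beyond the threshold [r], so that every rigid word through [U] is
   loxodromic. *)
have [n] := loxodromic_unbounded r lox; rewrite actE; set U := word_pow u n => rU.
have [qU _] := run_within_pow n qu ruq.
have [D DP] := num_rigid_through connL aw0 loop0 accE qU.
set a := num_readable (accessible A) in K1P DP.
have a0 : (0 < a 0)%N.
  apply/card_gt0P; exists [tuple]; rewrite finset.inE; apply/existsP; exists q.
  by rewrite /run_within /= (run_within_start qu).
have [K2 K2P] := sum_shift_le D a0 (num_readable_subadditive (accessible A)).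
(* Both counts are compared with [T l]: the extension to a rigid word through [U] spends [D]
   letters, leaving length at most [l - D] for the accessible word. *)
pose T l := (\sum_(m < (l - D).+1) a m)%N.
have T0 l : (0 < T l)%N by rewrite /T big_ord_recl /= addn_gt0 a0.
pose Q := rigid_loxodromic act P A nf.
pose accQ w := accepts A w && `[< Q (word_arrow letter o w) >].
have lower l : (D <= l)%N -> (T l <= finite_card (nf_ball G nf l `&` Q))%N.
  move=> Dl; rewrite (finite_card_ball _ _ nfP) -/accQ.
  (* The spheres of radius below [D] are discarded. *)
  have -> : (l.+1 = D + (l - D).+1)%N by rewrite addnS subnKC.
  rewrite big_split_ord /=; apply: leq_trans (leq_addl _ _).
  apply: leq_sum => m _; apply: leq_trans (DP m) _.
  apply: leq_count_words => w _ /asboolP Uw; have rig := Uw.1.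
  have aw : accepts A w by have := rig 1%N isT; rewrite /word_pow /= cats0.
  have [_ _ nfw] := accepted_arrow nfP aw.
  rewrite /accQ aw; apply/asboolP; split; first by rewrite nfw.
  exact: rP rU Uw.
have sub l : (finite_card (nf_ball G nf l `&` Q) <= finite_card (nf_ball G nf l))%N.
  rewrite -[X in (_ <= finite_card X)%N]setIT !(finite_card_ball _ _ nfP).
  apply: leq_sum => m _; apply: leq_count_words => w _ /andP[-> _] /=.
  exact/asboolP.
have upper l : (D <= l)%N ->
    (finite_card (nf_ball G nf l))%:R <= K1 * (K2%:R * (T l)%:R) :> R.
  move=> Dl; rewrite -[nf_ball _ _ _]setIT (finite_card_ball _ _ nfP) natr_sum.
  apply: (@le_trans _ _ (\sum_(m < l.+1) K1 * (a m)%:R)).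
    apply: ler_sum => m _; apply: le_trans (K1P m).
    by rewrite ler_nat; apply: leq_count_words => w _ /andP[].
  by rewrite -mulr_sumr ler_pM2l // -natr_sum -natrM ler_nat K2P.
have ball0 l : (D <= l)%N -> 0 < (finite_card (nf_ball G nf l))%:R :> R.
  by move=> Dl; rewrite ltr0n; apply: leq_trans (T0 l) (leq_trans (lower l Dl) (sub l)).
have K20 : 0 < K2%:R :> R.
  have := lt_le_trans (ball0 D (leqnn _)) (upper D (leqnn _)).
  by rewrite pmulr_rgt0 // pmulr_lgt0 // ltr0n T0.
(* The ball has at most [K1 * K2 * T l] elements, and at least [T l] of them are rigid and
   loxodromic. *)
apply: (@lt_le_trans _ _ ((K1 * K2%:R)^-1)%:E).
  by rewrite lte_fin invr_gt0 mulr_gt0.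
apply: (@limn_einf_ge _ _ _ D) => l Dl; rewrite lee_fin.
rewrite ler_pdivlMr ?ball0 // ler_pdivrMl ?mulr_gt0 // -mulrA.
apply: le_trans (upper l Dl) _.
by rewrite ler_pM2l // ler_pM2l // ler_nat lower.
Qed.
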